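(* Let $d=2m+1\ge 5$ be an odd integer. Then $m+1$, $m+2$ and $2m+1$ are typical ranks for real bivariate homogeneous polynomials of degree $d$. That is, for each $t\in\{m+1,\,m+2,\,2m+1\}$ there is a non-empty subset $V_t\subseteq\mathbb{R}[x,y]_d$, open for the euclidean topology of the real vector space $\mathbb{R}[x,y]_d$, such that $Rsr(f)=t$ for all $f\in V_t$.
   Context: For an integer $d\ge 0$, $\mathbb{R}[x,y]_d$ denotes the $(d+1)$-dimensional real vector space of all homogeneous polynomials of degree $d$ in the two variables $x,y$ with real coefficients. For $f\in\mathbb{R}[x,y]_d$, the real rank $Rsr(f)$ is the minimal integer $r$ such that $f=\sum_{i=1}^{r}c_iL_i^d$ for some $c_i\in\mathbb{R}$ and some linear forms $L_i\in\mathbb{R}[x,y]_1$. An integer $t>0$ is called a typical rank in degree $d$ (for real bivariate degree $d$ forms) if there is a non-empty subset $V$ of $\mathbb{R}[x,y]_d$, open for the euclidean topology, such that $Rsr(f)=t$ for all $f\in V$. *)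

(* Defs.v *)
From HB Require Import structures.
From mathcomp Require Import all_boot all_order all_algebra.
(* The notations of mpoly clash with those of mathcomp-analysis, so
   {mpoly R[2]} is written mpoly 2 R and p@_m is written mcoeff m p. *)
From mathcomp Require Export -(notations) mpoly.
From mathcomp Require Import all_classical all_reals all_analysis.

Set Implicit Arguments.
Unset Strict Implicit.
Unset Printing Implicit Defensive.

Import Order.TTheory GRing.Theory Num.Theory.
Import numFieldNormedType.Exports.

Local Open Scope classical_set_scope.
Local Open Scope ring_scope.

(* R[x,y]_d is the library type dhomog 2 R d, with x = 'X_0 and y = 'X_1.  The
   i-th coordinate below is the coefficient of x^(d-i) y^i. *)
Definition form_coefs (R : realType) (d : nat) (f : dhomog 2 R d) :
    'rV[R]_d.+1 :=
  \row_(i < d.+1) mcoeff (Multinom [tuple (d - i)%N; i : nat]) f.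

(* form_coefs is a linear isomorphism onto R^(d+1) (form_coefs_linear and
   form_coefs_bij below), so the topology it induces is the euclidean topology
   of R[x,y]_d. *)
HB.instance Definition _ (R : realType) (d : nat) :=
  Topological.copy (dhomog 2 R d) (initial_topology (@form_coefs R d)).

Definition sum_of_powers (R : realType) (d : nat) (f : dhomog 2 R d)
    (r : nat) : Prop :=
  exists (c : 'I_r -> R) (L : 'I_r -> dhomog 2 R 1),
    (f : mpoly 2 R) = \sum_(i < r) c i *: (L i : mpoly 2 R) ^+ d.

(* The relation Rsr(f) = r. *)
Definition real_rank (R : realType) (d : nat) (f : dhomog 2 R d)
    (r : nat) : Prop :=
  sum_of_powers f r /\ forall s : nat, sum_of_powers f s -> (r <= s)%N.

Definition typical_rank (R : realType) (d t : nat) : Prop :=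
  (0 < t)%N /\
  exists V : set (dhomog 2 R d),
    [/\ V !=set0, open V & forall f, V f -> real_rank f t].

Lemma form_coefs_linear (R : realType) (d : nat) : linear (@form_coefs R d).
Proof.
by move=> a f g; apply/rowP => i; rewrite !mxE /= raddfD /= mcoeffZ.
Qed.

Lemma form_coefs_bij (R : realType) (d : nat) : bijective (@form_coefs R d).
Proof.
have mdeg2 (i j : nat) : mdeg (Multinom [tuple i; j]) = (i + j)%N.
  by rewrite mdegE !big_ord_recl big_ord0 addn0.
pose mon (i : 'I_d.+1) := Multinom [tuple (d - i)%N; i : nat].
have mon_deg i : mdeg (mon i) = d by rewrite mdeg2 subnK // -ltnS.
pose G (v : 'rV[R]_d.+1) : mpoly 2 R := \sum_i v 0 i *: mpolyX R (mon i).
have homG v : G v \is ishomog1 d mdeg.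
  apply: rpred_sum => i _; apply: rpredZ.
  by rewrite dhomogX; apply/eqP; exact: mon_deg.
have mon_inj : injective mon.
  by move=> i j /(congr1 (fun m : multinom 2 => m (lift ord0 ord0))) /val_inj.
have coefG v i : mcoeff (mon i) (G v) = v 0 i.
  rewrite raddf_sum /= (bigD1 i) //= mcoeffZ mcoeffX eqxx mulr1 big1 ?addr0 //.
  by move=> j ji; rewrite mcoeffZ mcoeffX (inj_eq mon_inj) (negPf ji) mulr0.
exists (fun v => DHomog (homG v)) => [f|v]; last first.
  by apply/rowP => i; rewrite mxE; exact: coefG.
apply: val_inj; apply/mpolyP => m /=.
have [md|md] := eqVneq (mdeg m) d; last first.
  by rewrite !(@dhomog_nemf_coeff _ _ mdeg d) ?dhomog_is_dhomog.
have m01 : (m ord0 + m (lift ord0 ord0))%N = d.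
  by rewrite -md mdegE !big_ord_recl big_ord0 addn0.
have lt_m : (m (lift ord0 ord0) < d.+1)%N by rewrite ltnS -m01 leq_addl.
suff -> : m = mon (Ordinal lt_m) by rewrite coefG mxE.
apply/mnmP => j; case: (unliftP ord0 j) => [k|] -> //; first by rewrite ord1.
by transitivity (d - m (lift ord0 ord0))%N; rewrite // -m01 addnK.
Qed.

(* Main.v *)
Require Import Defs.
From HB Require Import structures.
From mathcomp Require Import all_boot all_order all_algebra.
From mathcomp Require Import polyrcf ring lra zify.
From mathcomp Require Import all_classical all_reals all_analysis.

Set Implicit Arguments.
Unset Strict Implicit.
Unset Printing Implicit Defensive.

Import Order.TTheory GRing.Theory Num.Theory.
Import numFieldNormedType.Exports.

Local Open Scope ring_scope.

(** Write a form of degree d as the sum of the 'C(d, k) a_k x^(d-k) y^k, and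
    pair it with polynomials p of degree at most d by \sum_k p_k a_k. Then f
    is a combination of the (x + t_i y)^d, for distinct t_1, ..., t_r, exactly
    when all multiples of \prod_i ('X - t_i) of degree at most d pair to 0
    with f (power_sum_of_split_annihilator and pairing_root_powers); any sum
    of r powers is in the same way annihilated by a product of at most r real
    linear factors (power_sum_annihilator). Ranks are thus read off from the
    apolar polynomials of f that are products of real linear factors.

    For d = 2m + 1 and f with invertible Hankel matrix (a_(i+j)), 0 <= i, j <=
    m, there is no apolar polynomial of degree at most m, and one of degree m
    + 1, up to scalars, depending continuously on f; Cramer's rule gives it,
    and also a continuous choice of an apolar polynomial of degree m + 2
    (corrector). Having r distinct real roots is ensured by sign changes at
    fixed points, an open condition (alternates). If the polynomial of degree
    m + 1 has this property, the rank is m + 1. If instead it violates the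
    Laguerre inequality p'^2 - p p'' >= 0 satisfied by polynomials with real
    roots only, again an open condition, then the rank is at least m + 2, and
    it is m + 2 when the chosen polynomial of degree m + 2 changes sign m + 2
    times.

    The rank d comes from forms f having d distinct real roots. A sum of s < d
    powers of linear forms has at most s zeros in the projective line unless
    it is 0 (linear_powers_few_zeros): this is Rolle's theorem, applied to the
    derivative in the direction killing one of the linear forms. Conversely d
    powers are enough, since d is odd: apolarity of \prod_i ('X - n_i / s),
    for fixed nodes n_i, is a polynomial equation of odd degree in s
    (power_sum_of_odd_degree). *)

(** * The apolarity pairing *)

(** The apolarity pairing of a form of degree N-1 with a polynomial: if the
    form is the sum over k of 'C(N-1, k) a_k x^(N-1-k) y^k, then (x + t
    y)^(N-1) has a_k = t^k and its pairing with p is p.[t]. The bound N makes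
    the pairing depend on the coefficients of the form only. *)
Definition pairing (R : comNzRingType) (N : nat) (a : nat -> R)
    (p : {poly R}) : R :=
  \sum_(k < N) p`_k * a k.

Lemma pairing_is_linear (R : comNzRingType) N (a : nat -> R) :
  linear_for *%R (pairing N a).
Proof.
move=> c p q; rewrite /pairing mulr_sumr -big_split /=.
by apply: eq_bigr => k _; rewrite coefD coefZ mulrDl mulrA.
Qed.

HB.instance Definition _ (R : comNzRingType) N (a : nat -> R) :=
  GRing.isLinear.Build R {poly R} R *%R (pairing N a) (pairing_is_linear N a).

Lemma pairingZ (R : comNzRingType) N (a : nat -> R) c p :
  pairing N a (c *: p) = c * pairing N a p.
Proof. by rewrite linearZ. Qed.

Lemma pairingB (R : comNzRingType) N (a : nat -> R) p q :
  pairing N a (p - q) = pairing N a p - pairing N a q.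
Proof. by rewrite linearB. Qed.

Lemma eq_pairing (R : comNzRingType) N (a b : nat -> R) p :
  (forall k, (k < N)%N -> a k = b k) -> pairing N a p = pairing N b p.
Proof. by move=> ab; apply: eq_bigr => k _; rewrite ab. Qed.

Lemma pairingXn (R : comNzRingType) N (a : nat -> R) k :
  (k < N)%N -> pairing N a 'X^k = a k.
Proof.
move=> kN; rewrite /pairing (bigD1 (Ordinal kN)) //= coefXn eqxx mul1r.
rewrite big1 ?addr0 // => i ik; rewrite coefXn; case: eqP => [e|];
  last by rewrite mul0r.
by case/eqP: ik; apply: val_inj.
Qed.

Lemma poly_sum_widen (R : nzRingType) N (p : {poly R}) :
  (size p <= N)%N -> p = \sum_(k < N) p`_k *: 'X^k.
Proof.
move=> sp; rewrite -poly_def; apply/polyP => k; rewrite coef_poly.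
by case: ltnP => // Nk; rewrite nth_default // (leq_trans sp).
Qed.

Lemma size_polyM_le (R : nzRingType) (p q : {poly R}) m n k :
  (size p <= m)%N -> (size q <= n)%N -> (m + n <= k.+1)%N ->
    (size (p * q)%R <= k)%N.
Proof.
move=> pm qn mnk; apply: leq_trans (size_polyMleq _ _) _.
by rewrite -subn1 leq_subLR add1n (leq_trans _ mnk) // leq_add.
Qed.

(** The differential operator attached to u 'X - v lowers the degree of a form
    by one and kills the linear form u x + v y. Both the lower and the upper
    bounds on ranks peel off linear factors with this identity. *)
Lemma pairing_linear_factor (R : comNzRingType) N (a : nat -> R) (u v : R)
    (q : {poly R}) :
  (size q <= N)%N ->
  pairing N.+1 a ((u *: 'X - v%:P) * q)
    = pairing N (fun k => u * a k.+1 - v * a k) q.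
Proof.
move=> sq; rewrite {1}(poly_sum_widen sq) mulr_sumr linear_sum /=.
apply: eq_bigr => k _; rewrite -scalerAr linearZ /= mulrBl -scalerAl -exprS.
rewrite mul_polyC linearB /= !linearZ /= !pairingXn ?ltnS //.
exact: ltnW.
Qed.

Lemma pairing_powers (R : comNzRingType) N (I : Type) (r : seq I) (c t : I -> R)
    (p : {poly R}) :
  (size p <= N)%N ->
  pairing N (fun k => \sum_(i <- r) c i * t i ^+ k) p
    = \sum_(i <- r) c i * p.[t i].
Proof.
move=> sp; rewrite /pairing; under eq_bigr do rewrite mulr_sumr.
rewrite exchange_big /=; apply: eq_bigr => i _.
rewrite (horner_coef_wide _ sp) mulr_sumr.
by apply: eq_bigr => k _; rewrite mulrCA.
Qed.

(** The moments of the form \sum c (u x + v y)^d, for xs the list of the (c,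
    (u, v)). *)
Definition power_sum (R : comNzRingType) (xs : seq (R * (R * R))) (d k : nat) :
    R :=
  \sum_(w <- xs) w.1 * (w.2.1 ^+ (d - k) * w.2.2 ^+ k).

(** The Laguerre expression p'^2 - p p'' at 0. It is nonnegative when all the
    roots of p are real, and its negativity is an open condition on p. *)
Definition laguerre0 (R : comNzRingType) (p : {poly R}) : R :=
  p`_1 ^+ 2 - (p`_0 * p`_2) *+ 2.

(** This carries nonnegativity from linear factors to their products. *)
Lemma laguerre0M (R : comNzRingType) (p q : {poly R}) :
  laguerre0 (p * q) = q`_0 ^+ 2 * laguerre0 p + p`_0 ^+ 2 * laguerre0 q.
Proof.
rewrite /laguerre0 !coefM !big_ord_recr !big_ord0 /= /bump /=.
rewrite ?(subn0, subnn, subSS) /=; ring.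
Qed.

Lemma laguerre0Z (R : comNzRingType) c (p : {poly R}) :
  laguerre0 (c *: p) = c ^+ 2 * laguerre0 p.
Proof. rewrite /laguerre0 !coefZ; ring. Qed.

(** The product of the u_i 'X - v_i over the terms c_i (u_i x + v_i y)^d
    annihilates the form. Degenerate terms, with (u_i, v_i) = 0, contribute no
    factor, so that the annihilator is not 0; terms with u_i = 0 contribute a
    constant, which lowers its degree. *)
Lemma power_sum_annihilator (R : realFieldType) (xs : seq (R * (R * R))) d :
  (size xs <= d)%N ->
  exists g : {poly R}, [/\ g != 0, (size g <= (size xs).+1)%N,
    0 <= laguerre0 g &
    forall q : {poly R}, (size q + size xs <= d.+1)%N ->
      pairing d.+1 (power_sum xs d) (g * q) = 0].
Proof.
have [n] := ubnP (size xs); elim: n => // n IH in xs d *.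
case: xs => [_ _|[c0 [u0 v0]] xs /= lt_n sd].
  exists 1; rewrite oner_eq0 size_poly1; split => // [|q _].
    by rewrite /laguerre0 !coef1 /= mulr0 mul0rn subr0 expr0n.
  by rewrite /pairing big1 // => k _; rewrite /power_sum big_nil mulr0.
rewrite ltnS in lt_n.
have [/andP[/eqP u00 /eqP v00]|uv0] := boolP ((u0 == 0) && (v0 == 0)).
  have [g [g0 sg lg ag]] := IH _ d lt_n (ltnW sd).
  exists g; split=> // [|q sq]; first exact: leqW.
  rewrite -[RHS](ag q); last by rewrite addnS in sq; exact: ltnW.
  apply: eq_pairing => k kd; rewrite /power_sum big_cons /= u00 v00 -exprD.
  by rewrite subnK // expr0n gtn_eqF ?mulr0 ?add0r // (leq_trans _ sd).
case: d sd => // d; rewrite ltnS => sd.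
(* contracting by the first linear form kills its term and rescales the others *)
pose ys := [seq (w.1 * (u0 * w.2.2 - v0 * w.2.1), w.2) | w <- xs].
have sys : size ys = size xs by rewrite size_map.
have [||g] := IH ys d; rewrite ?sys // => -[g0 sg lg ag].
have l0 : u0 *: 'X - v0%:P != 0 :> {poly R}.
  apply: contra uv0 => /eqP/polyP e; apply/andP; split; apply/eqP.
    by have := e 1; rewrite coefB coefZ coefX coefC coef0 mulr1 subr0.
  by have /eqP := e 0; rewrite coefB coefZ coefX coefC coef0 mulr0 sub0r
    oppr_eq0 => /eqP.
have sl : (size (u0 *: 'X - v0%:P)%R <= 2)%N.
  apply/leq_sizeP => j j2; rewrite coefB coefZ coefX coefC.
  by case: j j2 => [|[|j]] //; rewrite mulr0 subr0.
exists ((u0 *: 'X - v0%:P) * g); split.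
- by rewrite mulf_neq0.
- apply: leq_trans (size_polyMleq _ _) _.
  by move: sl sg; lia.
- rewrite laguerre0M; apply: addr_ge0; apply: mulr_ge0; rewrite ?sqr_ge0 //.
  rewrite /laguerre0 !coefB !coefZ !coefX !coefC /=.
  by rewrite !(mulr0, mul0rn, mulr1, subr0) ?sqr_ge0.
move=> q /= sq; rewrite -mulrA pairing_linear_factor; last first.
  by rewrite (size_polyM_le sg (leqnn _)) // addnC.
rewrite -[RHS](ag q); last by rewrite addnS ltnS in sq.
apply: eq_pairing => k kd; rewrite /power_sum !big_cons big_map /=.
rewrite !mulrDr opprD addrACA [X in X + _ = _](_ : _ = 0) ?add0r; last first.
  rewrite subSS subSn // !exprS; ring.
rewrite !mulr_sumr -sumrB; apply: eq_bigr => w _.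
rewrite subSS subSn // !exprS; ring.
Qed.

(** If 'X - t0 times the rest annihilates a, then the rest annihilates the
    contracted sequence a_(k+1) - t0 a_k, which is therefore a combination of
    powers of the other roots. Solving this first order recurrence for a adds
    one geometric sequence of ratio t0. *)
Lemma power_sum_of_split_annihilator (R : fieldType) N (a : nat -> R) ts :
  uniq ts -> (size ts <= N)%N ->
  (forall q : {poly R}, (size q + size ts <= N)%N ->
     pairing N a (\prod_(t <- ts) ('X - t%:P) * q) = 0) ->
  exists c : R -> R, forall k, (k < N)%N -> a k = \sum_(t <- ts) c t * t ^+ k.
Proof.
elim: ts N a => [|t0 ts IH] N a /=.
  move=> _ _ aq; exists (fun=> 0) => k kN; rewrite big_nil.
  rewrite -(pairingXn a kN) -(aq 'X^k) ?big_nil ?mul1r //.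
  by rewrite size_polyXn addn0.
case: N => // N /andP[t0ts uts]; rewrite ltnS => sN aq.
have [|c ac] := IH N (fun k => 1 * a k.+1 - t0 * a k) uts sN.
  move=> q sq; rewrite -pairing_linear_factor; last first.
    apply: (@size_polyM_le _ _ _ (size ts).+1 (size q)) => //.
      by rewrite size_prod_XsubC.
    by rewrite addSn addnC ltnS.
  by rewrite scale1r mulrA; have := aq q; rewrite big_cons => -> //;
    rewrite addnS ltnS.
pose b k := a k - \sum_(t <- ts) c t / (t - t0) * t ^+ k.
have bS k : (k < N)%N -> b k.+1 = t0 * b k.
  move=> kN; apply/eqP; rewrite -subr_eq0 /b.
  rewrite (_ : _ - _ = (1 * a k.+1 - t0 * a k) - (\sum_(t <- ts) c t / (t - t0)
    * t ^+ k.+1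
     - t0 * \sum_(t <- ts) c t / (t - t0) * t ^+ k)); last by ring.
  rewrite (ac k kN) mulr_sumr -sumrB -sumrB big1_seq // => t /andP[_ tts].
  have tt0 : t - t0 != 0 by rewrite subr_eq0; apply: contraNneq t0ts => <-.
  by rewrite exprS; field.
have bE k : (k < N.+1)%N -> b k = b 0%N * t0 ^+ k.
  elim: k => [|k IHk] kN; first by rewrite expr0 mulr1.
  by rewrite bS // IHk 1?ltnW // exprS; ring.
exists (fun t => if t == t0 then b 0%N else c t / (t - t0)) => k kN.
rewrite big_cons eqxx -bE // /b -[LHS](subrK (\sum_(t <- ts) c t / (t - t0) * t
  ^+ k)).
congr (_ + _); apply: eq_big_seq => t tts.
by case: eqP tts => // ->; rewrite (negPf t0ts).
Qed.

(** * Counting real roots by signs *)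

Lemma rolle_path (R : rcfType) (p : {poly R}) x (ts : seq R) :
  path <%R x ts -> all (root p) (x :: ts) ->
  exists us, [/\ size us = size ts, path <%R x us & all (root p^`()) us].
Proof.
elim: ts x => [|y ts IH] x /=; first by exists [::].
move=> /andP[xy py] /and3P[px pyr pts].
have [|us [su pus rus]] := IH y py; first by rewrite /= pyr.
have [|c] := @poly_rolle _ x y p xy; first by rewrite (rootP px) (rootP pyr).
rewrite in_itv /= => /andP[xc cy] pc.
exists (c :: us); split; rewrite /= ?su //.
  rewrite xc; case: us {su rus} pus => //= z us /andP[yz ->].
  by rewrite (lt_trans cy yz).
by rewrite rus andbT; apply/rootP.
Qed.

Lemma rolle_roots (R : rcfType) (p : {poly R}) (ts : seq R) :
  uniq ts -> all (root p) ts ->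
  exists us, [/\ uniq us, (size us).+1 >= size ts & all (root p^`()) us]%N.
Proof.
move=> uts rts; pose ss := sort <=%R ts.
have sss : sorted <%R ss by rewrite sort_lt_sorted.
have rss : all (root p) ss by rewrite all_sort.
rewrite -(size_sort <=%R) -/ss.
case: ss sss rss => [|x ss] /= sss rss; first by exists [::].
have [us [su pus rus]] := rolle_path sss rss.
exists us; split; rewrite ?su //.
by move/path_sorted: pus; rewrite lt_sorted_uniq_le => /andP[].
Qed.

(** A sign condition at fixed points, open in the coefficients of p, which
    forces r distinct real roots. *)
Definition alternates (R : numDomainType) (p : {poly R}) (r : nat) :=
  forall j, (j < r)%N -> p.[(2 * j)%:R] * p.[(2 * j.+1)%:R] < 0.

Lemma alternates_roots (R : rcfType) (p : {poly R}) r :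
  alternates p r ->
  exists ts, [/\ uniq ts, size ts = r & all (root p) ts].
Proof.
move=> alt.
suff [ts [us st rt]] : exists ts, [/\ uniq ts, size ts = r &
    all (fun t => root p t && (t < (2 * r)%:R)) ts].
  by exists ts; split=> //; apply: sub_all rt => t /andP[].
elim: r alt => [|r IH] alt; first by exists [::].
have [|ts [us st rt]] := IH; first by move=> j jr; apply: alt; exact: ltnW.
have ler : (2 * r)%:R <= (2 * r.+1)%:R :> R by rewrite ler_nat leq_mul2l leqnSn.
have [t] := poly_ivtoo ler (alt r (ltnSn r)).
rewrite in_itv /= => /andP[rt1 rt2] pt; exists (t :: ts); split=> /=.
- rewrite us andbT; apply/negP => /(allP rt) /andP[_].
  by rewrite ltNge (ltW rt1).
- by rewrite st.
- rewrite pt rt2; apply: sub_all rt => s /andP[-> /=] /lt_le_trans; exact.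
Qed.

(** One node in each of the intervals whose end points are used by alternates. *)
Definition odd_nodes (R : nzRingType) r : seq R :=
  [seq (2 * i).+1%:R | i <- iota 0 r].

Lemma odd_nodes_uniq (R : numDomainType) r : uniq (odd_nodes R r).
Proof.
rewrite map_inj_uniq ?iota_uniq // => i j /eqP.
by rewrite eqr_nat eqSS eqn_mul2l => /eqP.
Qed.

Lemma size_odd_nodes (R : nzRingType) r : size (odd_nodes R r) = r.
Proof. by rewrite size_map size_iota. Qed.

Lemma alternates_odd_nodes (R : realDomainType) r (c : R) : c != 0 ->
  alternates (c *: \prod_(t <- odd_nodes R r) ('X - t%:P)) r.
Proof.
move=> c0 j jr; rewrite !hornerZ mulrACA -expr2 pmulr_rlt0 ?exprn_even_gt0 //.
rewrite !horner_prod -big_split /= big_map.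
rewrite (bigD1_seq j) ?iota_uniq ?mem_iota //= pmulr_llt0.
  rewrite !hornerXsubC -[(2 * j).+1]addn1 mulnS !natrD; lra.
apply: prodr_gt0 => i ij; rewrite !hornerXsubC.
rewrite -[(2 * i).+1]addn1 mulnS !natrD.
case: (ltngtP i j) ij => // [lij|lji] _.
  have : (2 * i)%:R + 2 <= (2 * j)%:R :> R by rewrite -natrD ler_nat -mulnSr
    leq_mul2l.
  by move=> h; apply: mulr_gt0; lra.
have : (2 * j)%:R + 2 <= (2 * i)%:R :> R by rewrite -natrD ler_nat -mulnSr
  leq_mul2l.
by move=> h; rewrite nmulr_rgt0; lra.
Qed.

Lemma alternates_neq0 (R : numDomainType) (p : {poly R}) r :
  alternates p r -> (0 < r)%N -> p.[0] != 0.
Proof.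
by move=> alt /alt; rewrite muln0; apply: contraTneq => ->; rewrite mul0r ltxx.
Qed.

(** * Forms with too many real zeros for their number of terms *)

Definition linear_powers (R : comNzRingType) (xs : seq (R * (R * R))) n
    (x y : R) : R :=
  \sum_(w <- xs) w.1 * (w.2.1 * x + w.2.2 * y) ^+ n.

Definition wedge (R : comNzRingType) (P Q : R * R) : R := P.1 * Q.2 - P.2 * Q.1.

Lemma linear_powers_scale (R : comNzRingType) xs n (s x y : R) :
  linear_powers xs n (s * x) (s * y) = s ^+ n * linear_powers xs n x y.
Proof.
rewrite /linear_powers mulr_sumr; apply: eq_bigr => w _.
have -> : w.2.1 * (s * x) + w.2.2 * (s * y) =
  s * (w.2.1 * x + w.2.2 * y) by ring.
by rewrite exprMn mulrCA.
Qed.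

Definition line_restriction (R : comNzRingType) (xs : seq (R * (R * R))) n
    (P D : R * R) : {poly R} :=
  \sum_(w <- xs) w.1 *: ((w.2.1 * D.1 + w.2.2 * D.2) *: 'X
                         + (w.2.1 * P.1 + w.2.2 * P.2)%:P) ^+ n.

Lemma horner_line_restriction (R : comNzRingType) (xs : seq (R * (R * R))) n
    (P D : R * R) t :
  (line_restriction xs n P D).[t] =
    linear_powers xs n (P.1 + t * D.1) (P.2 + t * D.2).
Proof.
rewrite horner_sum; apply: eq_bigr => w _; rewrite !hornerE /=.
by congr (_ * _ ^+ _); ring.
Qed.

(** Up to the factor n, the derivative in direction D of a sum of n-th powers
    of linear forms is again such a sum, of degree n - 1, and the terms that
    vanish at D get the coefficient 0. *)
Definition polar (R : comNzRingType) (D : R * R) (xs : seq (R * (R * R))) :=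
  [seq (w.1 * (w.2.1 * D.1 + w.2.2 * D.2), w.2) | w <- xs].

Lemma deriv_line_restriction (R : comNzRingType) (xs : seq (R * (R * R))) n
    (P D : R * R) :
  (line_restriction xs n.+1 P D)^`() =
    n.+1%:R *: line_restriction (polar D xs) n P D.
Proof.
rewrite /line_restriction big_map linear_sum scaler_sumr;
  apply: eq_bigr => w _ /=.
rewrite derivZ deriv_exp derivD derivZ derivX derivC addr0 -scaler_nat.
by rewrite -scalerAl mul1r !scalerA mulrA; congr (_ *: _); ring.
Qed.

Lemma linear_powers_polar_self (R : comNzRingType) (xs : seq (R * (R * R))) n
    (D : R * R) :
  linear_powers xs n.+1 D.1 D.2 = linear_powers (polar D xs) n D.1 D.2.
Proof.
by rewrite /linear_powers big_map; apply: eq_bigr => w _ /=;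
  rewrite exprS mulrA.
Qed.

(** A sum of s powers with more than s zeros in the projective line is 0. Let
    D be the zero of one of the linear forms. On an affine line of direction
    D, which meets every other direction once, the form is a polynomial in one
    variable, and Rolle gives all but one of its zeros to the derivative in
    direction D; if D itself is a zero of the form, it is a zero of this
    derivative by Euler's identity. So the derivative, which has s - 1 terms,
    has more than s - 1 zeros. Once it is known to vanish, the form is
    constant on the affine line, where it has a zero, and homogeneity
    concludes. *)
Lemma linear_powers_few_zeros (R : rcfType) (xs : seq (R * (R * R))) n
    (Ps : seq (R * R)) :
  (size xs <= n)%N -> (size xs < size Ps)%N ->
  pairwise (fun P Q => wedge P Q != 0) Ps -> all (fun P => P != 0) Ps ->
  all (fun P => linear_powers xs n P.1 P.2 == 0) Ps ->
  forall x y, linear_powers xs n x y = 0.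
Proof.
have [k] := ubnP (size xs); elim: k => // k IH in xs n Ps *.
case: xs => [|[c0 [u0 v0]] xs] /=; first by move=> *;
  rewrite /linear_powers big_nil.
rewrite ltnS => lt_k sn sPs pw nz zs.
have [/andP[/eqP u00 /eqP v00]|uv0] := boolP ((u0 == 0) && (v0 == 0)).
  have dropE x y : linear_powers ((c0, (u0, v0)) ::
    xs) n x y = linear_powers xs n x y.
    rewrite /linear_powers big_cons /= u00 v00 !mul0r addr0 expr0n gtn_eqF
      ?mulr0 ?add0r //.
    exact: leq_ltn_trans sn.
  move=> x y; rewrite dropE; apply: (IH xs n Ps) => //;
    [exact: ltnW|exact: ltnW|].
  by rewrite (eq_all (a2 := fun P => linear_powers xs n P.1 P.2 == 0)) in zs =>
    // P; rewrite dropE.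
case: n sn zs => // n sn zs; rewrite ltnS in sn.
set F := linear_powers (_ :: _) _ in zs *.
(* E is orthogonal to D, so (l P / N, (u0 P.2 - v0 P.1) / N) are the
   coordinates of P in the basis (E, D), and rho P is their ratio. *)
pose D : R * R := (- v0, u0); pose E : R * R := (u0, v0).
pose l (P : R * R) := u0 * P.1 + v0 * P.2.
pose N := u0 ^+ 2 + v0 ^+ 2.
have N0 : N != 0 by rewrite paddr_eq0 ?sqr_ge0 // !sqrf_eq0.
pose rho (P : R * R) := (u0 * P.2 - v0 * P.1) / l P.
pose at_ (t : R) : R * R := (E.1 + t * D.1, E.2 + t * D.2).
have at_rho P : l P != 0 ->
    P.1 = l P / N * (at_ (rho P)).1 /\ P.2 = l P / N * (at_ (rho P)).2.
  by move: N0; rewrite /rho /at_ /l /N /= => N0 lP; split; field; rewrite lP N0.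
have FD : F D.1 D.2 = linear_powers (polar D xs) n D.1 D.2.
  rewrite /F linear_powers_polar_self /linear_powers big_cons /=.
  by rewrite [_ + v0 * u0](_ : _ = 0) ?mulr0 ?mul0r ?add0r //; ring.
pose phi := line_restriction ((c0, (u0, v0)) :: xs) n.+1 E D.
have phiE t : phi.[t] =
  F (at_ t).1 (at_ t).2 by rewrite horner_line_restriction.
have dphiE t : phi^`().[t]
    = n.+1%:R * linear_powers (polar D xs) n (at_ t).1 (at_ t).2.
  rewrite deriv_line_restriction hornerZ horner_line_restriction.
  rewrite {1}/linear_powers big_cons /=.
  by rewrite [_ + v0 * u0](_ : _ = 0) ?mulr0 ?mul0r ?add0r //; ring.
pose ts := [seq rho P | P <- Ps & l P != 0].
have rts : all (root phi) ts.
  apply/allP => _ /mapP[P + ->]; rewrite mem_filter => /andP[lP PPs].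
  have /allP/(_ _ PPs) := zs; have [-> ->] := at_rho P lP.
  rewrite /F linear_powers_scale mulf_eq0 expf_eq0 /= mulf_eq0 invr_eq0.
  by rewrite (negPf lP) (negPf N0) /= rootE phiE.
have uts : uniq ts.
  rewrite uniq_pairwise pairwise_map.
  apply: (sub_in_pairwise (P := fun P =>
    l P != 0)) (filter_all _ _) (pairwise_filter _ pw).
  move=> P Q lP lQ; apply: contra_neq => rPQ.
  have [p1 p2] := at_rho P lP; have [q1 q2] := at_rho Q lQ.
  by rewrite /wedge p1 p2 q1 q2 rPQ; ring.
have wedge_at s t : wedge (at_ s) (at_ t) = (t - s) * N.
  by rewrite /wedge /N /=; ring.
have wedgeD t : wedge D (at_ t) = - N by rewrite /wedge /N /=; ring.
have [us [uus sus rus]] := rolle_roots uts rts.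
have on_D P : P != 0 -> l P = 0 -> exists2 s, s != 0 & P = (s * D.1, s * D.2).
  move=> P0 lP.
  have P1 : P.1 = (u0 * P.2 - v0 * P.1) / N * D.1.
    have : l P * (u0 / N) = 0 by rewrite lP mul0r.
    rewrite /l /D /= => h.
    move: N0 h; rewrite /N => N0 h; apply/eqP;
      rewrite -subr_eq0 -[X in _ == X]h.
    by apply/eqP; field.
  have P2 : P.2 = (u0 * P.2 - v0 * P.1) / N * D.2.
    have : l P * (v0 / N) = 0 by rewrite lP mul0r.
    rewrite /l /D /= => h.
    move: N0 h; rewrite /N => N0 h; apply/eqP;
      rewrite -subr_eq0 -[X in _ == X]h.
    by apply/eqP; field.
  exists ((u0 * P.2 - v0 * P.1) / N).
    apply: contraNneq P0 => s0; move: P1 P2; rewrite s0 !mul0r.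
    by case: P {lP s0} => /= ? ? -> ->.
  by rewrite -P1 -P2; case: (P).
have few_on_D : (count (fun P => l P == 0)%R Ps <= 1)%N.
  have := pairwise_filter (fun P => l P == 0) pw.
  have : all (fun P => (l P == 0) && (P != 0)) [seq P <- Ps | l P == 0].
    by apply/allP => P; rewrite mem_filter => /andP[-> /(allP nz)].
  rewrite -size_filter; case: [seq P <- Ps | l P == 0] => [|P [|Q Qs]] //=.
  move=> /and3P[/andP[/eqP lP P0] /andP[/eqP lQ Q0] _] /andP[/andP[+ _] _].
  have [p _ ->] := on_D P P0 lP; have [q _ ->] := on_D Q Q0 lQ.
  by rewrite /wedge /=; case/eqP; ring.
have size_ts : (size ts + count (fun P => l P == 0)%R Ps = size Ps)%N.
  by rewrite size_map size_filter addnC count_predC.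
have [t0 pt0] : exists t, root phi t.
  have : (0 < size ts)%N.
    by rewrite -(ltn_add2r 1) (leq_trans _ (leq_add (leqnn _) few_on_D)) //
      size_ts; case: (Ps) sPs => [|? []].
  by case: ts rts {uts sus size_ts} => //= t ts /andP[pt _] _; exists t.
have G0 : forall x y, linear_powers (polar D xs) n x y = 0.
  pose Qs := (if all (fun P =>
    l P != 0) Ps then [::] else [:: D]) ++ map at_ us.
  have D0 : D != 0.
    by apply: contra uv0 => /eqP[/eqP + /eqP ->]; rewrite oppr_eq0 => ->.
  have wus : pairwise (fun P Q => wedge P Q != 0) (map at_ us).
    rewrite pairwise_map; move: uus; rewrite uniq_pairwise;
      apply: sub_pairwise => s t /= st.
    by rewrite wedge_at mulf_neq0 // subr_eq0 eq_sym.
  have nus : all (fun P => P != 0) (map at_ us).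
    rewrite all_map; apply/allP => t _ /=; apply: contra N0 => /eqP at0.
    by rewrite -oppr_eq0 -(wedgeD t) at0 /wedge !mulr0 subr0.
  have zus : all (fun P =>
    linear_powers (polar D xs) n P.1 P.2 == 0) (map at_ us).
    rewrite all_map; apply: sub_all rus => t; rewrite rootE dphiE mulf_eq0.
    by rewrite pnatr_eq0.
  apply: (IH _ _ Qs); rewrite ?size_map //; rewrite /Qs;
    case: ifPn => // someD /=.
  - rewrite size_map; move: size_ts; rewrite (_ : count _ _ = 0%N) ?addn0.
      by move=> e; rewrite -ltnS (leq_trans _ sus) // e.
    by apply/eqP; rewrite -leqn0 leqNgt -has_count -all_predC.
  - rewrite size_map (leq_trans _ sus) // -(ltn_add2r 1) addn1.
    by rewrite (leq_trans sPs) // -size_ts leq_add2l.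
  - rewrite wus andbT all_map; apply/allP => t _ /=.
    by rewrite wedgeD oppr_eq0.
  - by rewrite D0.
  - rewrite zus andbT.
    have [P PPs lP] : exists2 P, P \in Ps & l P = 0.
      by have /allPn[P PPs /negPn/eqP] := someD; exists P.
    have := allP zs P PPs; have [s s0 ->] := on_D P (allP nz P PPs) lP.
    rewrite /F linear_powers_scale mulf_eq0 expf_eq0 (negPf s0) /= -/F.
    by rewrite FD.
move=> x y.
have FE t : F (at_ t).1 (at_ t).2 = 0.
  have const a b : a < b -> phi.[b] = phi.[a].
    move=> ab; have [c _] := @poly_mvt _ a b phi ab.
    by rewrite dphiE G0 mulr0 mul0r => /eqP; rewrite subr_eq0 => /eqP.
  rewrite -phiE -(rootP pt0).
  by case: (ltgtP t t0) => [/const|/const|->].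
suff F0 P : F P.1 P.2 = 0 by exact: F0 (x, y).
have [lP|lP] := eqVneq (l P) 0; last first.
  have [-> ->] := at_rho P lP.
  by rewrite /F linear_powers_scale -/F FE mulr0.
have [->|P0] := eqVneq P 0.
  by rewrite /F /linear_powers big1 // => w _;
    rewrite !mulr0 addr0 expr0n mulr0.
have [s _ ->] := on_D P P0 lP.
by rewrite /F linear_powers_scale -/F FD G0 mulr0.
Qed.

(** * Sums of powers from split apolar polynomials *)

Lemma power_sum_of_roots (R : fieldType) N (a : nat -> R) (p : {poly R}) ts :
  p != 0 -> uniq ts -> all (root p) ts -> (size p <= (size ts).+1)%N ->
  (size ts <= N)%N ->
  (forall q : {poly R}, (size q + size ts <= N)%N -> pairing N a (p * q) = 0) ->
  exists c : R -> R, forall k, (k < N)%N -> a k = \sum_(t <- ts) c t * t ^+ k.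
Proof.
move=> p0 uts rts sp sN ap.
apply: power_sum_of_split_annihilator => // q sq.
have sp' : size p = (size ts).+1.
  by apply/eqP; rewrite eqn_leq sp max_poly_roots.
have := ap q sq; rewrite {1}(all_roots_prod_XsubC sp' rts);
  last by rewrite uniq_rootsE.
rewrite -scalerAl linearZ /= => /eqP; rewrite mulf_eq0 lead_coef_eq0 (negPf p0).
by move/eqP.
Qed.

Lemma power_sum_of_alternating (R : rcfType) N (a : nat -> R) (p : {poly R}) r :
  p != 0 -> alternates p r -> (size p <= r.+1)%N -> (r <= N)%N ->
  (forall q : {poly R}, (size q + r <= N)%N -> pairing N a (p * q) = 0) ->
  exists (ts : seq R) (c : R -> R), size ts = r /\
    forall k, (k < N)%N -> a k = \sum_(t <- ts) c t * t ^+ k.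
Proof.
move=> p0 /alternates_roots[ts [uts <- rts]] sp rN ap.
by have [c ac] := power_sum_of_roots p0 uts rts sp rN ap; exists ts, c.
Qed.

(** Scaling the nodes by 1/s turns the apolarity condition for \prod ('X - t)
    into a polynomial equation in s, of odd degree d since a_d != 0; its real
    roots are not 0 because a_0 != 0. *)
Lemma power_sum_of_odd_degree (R : rcfType) d (a : nat -> R) :
  odd d -> a 0%N != 0 -> a d != 0 ->
  exists (ts : seq R) (c : R -> R), size ts = d /\
    forall k, (k < d.+1)%N -> a k = \sum_(t <- ts) c t * t ^+ k.
Proof.
move=> od a0 ad.
pose W : {poly R} := \prod_(t <- odd_nodes R d) ('X - t%:P).
have sW : size W = d.+1 by rewrite size_prod_XsubC size_odd_nodes.
have Wd : W`_d = 1.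
  by have /monicP := monic_prod_XsubC (odd_nodes R d) xpredT id;
    rewrite lead_coefE -/W sW.
have W0 : W`_0 != 0.
  rewrite -horner_coef0 -rootE root_prod_XsubC; apply/mapP => -[i _ /eqP].
  by rewrite eq_sym pnatr_eq0.
pose Q := \poly_(k < d.+1) (W`_k * a k).
have sQ : size Q = d.+1 by rewrite size_poly_eq //= Wd mul1r.
have [|s Qs] := @odd_poly_root _ Q; first by rewrite sQ /= od.
have s0 : s != 0.
  apply: contraTneq Qs => ->; rewrite rootE horner_coef0 coef_poly /=.
  by rewrite mulf_neq0.
pose p := \poly_(k < d.+1) (W`_k * s ^+ k).
have pE x : p.[x] = W.[s * x].
  rewrite horner_poly (horner_coef_wide (n := d.+1)) ?sW //.
  by apply: eq_bigr => k _; rewrite exprMn mulrA.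
pose ts := [seq t / s | t <- odd_nodes R d].
have sts : size ts = d by rewrite size_map size_odd_nodes.
have [|||||q|c ac] := @power_sum_of_roots _ d.+1 a p ts.
- apply/eqP => p0; have := coef0 R 0; rewrite -p0 coef_poly /= expr0 mulr1.
  exact/eqP.
- by rewrite map_inj_uniq ?odd_nodes_uniq //; apply: mulIf; rewrite invr_eq0.
- apply/allP => _ /mapP[t tn ->]; rewrite rootE pE mulrC divfK //.
  by rewrite -rootE root_prod_XsubC.
- by rewrite sts size_poly.
- by rewrite sts leqnSn.
- rewrite sts -[d.+1]add1n leq_add2r => sq1; have /size1_polyC -> := sq1.
  have pQ : pairing d.+1 a p = Q.[s].
    rewrite /Q horner_poly; apply: eq_bigr => k _.
    by rewrite coef_poly ltn_ord mulrAC.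
  by rewrite mulrC mul_polyC linearZ /= add1n pQ (rootP Qs) mulr0.
by exists ts, c.
Qed.

(** * Hankel matrices and apolar polynomials of low degree *)

(** The middle catalecticant of a form of degree 2m or 2m + 1. *)
Definition hankel (R : comNzRingType) m (a : nat -> R) : 'M[R]_m.+1 :=
  \matrix_(i, j) a (i + j)%N.

(** The row vector b is read as a polynomial of degree at most m. *)
Lemma pairing_hankel (R : comNzRingType) N m (a : nat -> R) (b : 'rV[R]_m.+1)
    (i : 'I_m.+1) :
  (m + i < N)%N -> pairing N a (rVpoly b * 'X^i) = (b *m hankel m a) 0 i.
Proof.
move=> miN; rewrite (@poly_sum_widen _ m.+1 (rVpoly b)) ?size_poly //.
rewrite mulr_suml linear_sum mxE; apply: eq_bigr => j _ /=.
rewrite -scalerAl linearZ /= -exprD pairingXn; last first.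
  by rewrite (leq_ltn_trans _ miN) // leq_add2r -ltnS.
by rewrite coef_rVpoly_ord mxE.
Qed.

Lemma hankel_kernel (R : fieldType) N m (a : nat -> R) (p : {poly R}) :
  \det (hankel m a) != 0 -> (2 * m < N)%N -> (size p <= m.+1)%N ->
  (forall i, (i <= m)%N -> pairing N a (p * 'X^i) = 0) -> p = 0.
Proof.
move=> dH mN sp ap; have pK := poly_rV_K sp.
have pH : poly_rV p *m hankel m a = 0 :> 'rV_m.+1.
  apply/rowP => i; rewrite [RHS]mxE.
  have iN : (m + i < N)%N by rewrite (leq_ltn_trans _ mN) // mul2n -addnn
    leq_add2l -ltnS.
  have im : (i <= m)%N by rewrite -ltnS.
  have e := pairing_hankel a (poly_rV p) iN.
  transitivity (pairing N a (rVpoly (poly_rV p : 'rV_m.+1) * 'X^i));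
    first exact: esym.
  by rewrite pK; exact: ap.
rewrite -pK; have -> : poly_rV p = 0 :> 'rV_m.+1; last by rewrite linear0.
have uH : hankel m a \in unitmx by rewrite unitmxE unitfE.
by rewrite -(mulmxK uH (poly_rV p)) pH mul0mx.
Qed.

Lemma hankel_nondegenerate (R : fieldType) N m (a : nat -> R) :
  (2 * m < N)%N ->
  (forall p : {poly R}, (size p <= m.+1)%N ->
     (forall i, (i <= m)%N -> pairing N a (p * 'X^i) = 0) -> p = 0) ->
  \det (hankel m a) != 0.
Proof.
move=> mN inj; apply/negP => /det0P[v v0 vH]; case/eqP: v0.
have /(congr1 (@poly_rV _ m.+1)) : rVpoly v = 0.
  apply: inj => [|i im]; first exact: size_poly.
  have := @pairing_hankel _ N m a v (Ordinal (im : (i < m.+1)%N));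
    rewrite vH mxE; apply.
  by rewrite (leq_ltn_trans _ mN) //= mul2n -addnn leq_add2l.
by rewrite rVpolyK linear0.
Qed.

(** Only the pairings h * 'X^i that fit in the degree of the form count as
    constraints: the others have no meaning for it, and replacing them by 0
    lets one matrix serve for h of degree m + 1 (no truncated constraint) and
    of degree m + 2 (the last one is truncated). *)
Definition corrector_row (R : comNzRingType) N m (a : nat -> R) (h : {poly R}) :
    'rV[R]_m.+1 :=
  \row_i (if (size h + i <= N)%N then pairing N a (h * 'X^i) else 0).

(** A multiple of h plus a correction of degree at most m, which is apolar to
    the form and depends polynomially on it. Cramer's rule gives the
    correction, and clearing the denominator makes it continuous everywhere. *)
Definition corrector (R : comNzRingType) N m (a : nat -> R) (h : {poly R}) :
    {poly R} :=
  \det (hankel m a) *: h - rVpoly (corrector_row N m a h *m \adj (hankel m a)).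

Lemma corrector_annihilates (R : comNzRingType) N m (a : nat -> R)
    (h q : {poly R}) :
  (2 * m < N)%N -> (size q <= m.+1)%N -> (size q + size h <= N.+1)%N ->
  pairing N a (corrector N m a h * q) = 0.
Proof.
move=> mN sq sqh; rewrite (poly_sum_widen (leqnn (size q))) mulr_sumr linear_sum
  big1 // => i _.
have im : (i < m.+1)%N by rewrite (leq_trans (ltn_ord i)).
rewrite -scalerAr linearZ /= mulrBl linearB /= -scalerAl linearZ /=.
rewrite (@pairing_hankel _ N m a _ (Ordinal im)); last first.
  by rewrite (leq_ltn_trans _ mN) //= mul2n -addnn leq_add2l.
rewrite -mulmxA mul_adj_mx mul_mx_scalar !mxE /= ifT ?subrr ?mulr0 //.
by rewrite -ltnS (leq_trans _ sqh) // addnC -addSn leq_add2r.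
Qed.

Lemma corrector_fixed (R : comNzRingType) N m (a : nat -> R) (h : {poly R}) :
  (forall i, (i <= m)%N -> (size h + i <= N)%N -> pairing N a (h * 'X^i) = 0) ->
  corrector N m a h = \det (hankel m a) *: h.
Proof.
move=> ah; rewrite /corrector (_ : corrector_row _ _ _ _ =
  0) ?mul0mx ?linear0 ?subr0 ?addr0 //.
by apply/rowP => i; rewrite !mxE; case: ifP => // ?; rewrite ah // -ltnS.
Qed.

Lemma size_corrector (R : comNzRingType) N m (a : nat -> R) (h : {poly R}) k :
  (m < k)%N -> (size h <= k)%N -> (size (corrector N m a h) <= k)%N.
Proof.
move=> mk hk; rewrite (leq_trans (size_polyD _ _)) // geq_max size_polyN.
by rewrite (leq_trans (size_scale_leq _ _)) //= (leq_trans (size_poly _ _)).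
Qed.

Lemma eq_corrector (R : comNzRingType) N m (a b : nat -> R) h :
  (2 * m < N)%N -> (forall k, (k < N)%N -> a k = b k) ->
  corrector N m a h = corrector N m b h.
Proof.
move=> mN ab.
have hE : hankel m a = hankel m b.
  apply/matrixP => i j; rewrite !mxE ab // (leq_ltn_trans _ mN) //.
  by rewrite mul2n -addnn leq_add // -ltnS.
rewrite /corrector hE (_ : corrector_row N m a h = corrector_row N m b h) //.
by apply/rowP => i; rewrite !mxE; case: ifP => // _; exact: eq_pairing.
Qed.

(** Where the determinant vanishes the corrector has degree at most m, too
    small for its number of roots. *)
Lemma det_hankel_of_corrector (R : rcfType) N m (a : nat -> R) (h : {poly R})
    r :
  (m < r)%N -> alternates (corrector N m a h) r -> \det (hankel m a) != 0.
Proof.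
move=> mr alt; apply/negP => /eqP dH.
have [ts [uts st rts]] := alternates_roots alt.
have c0 : corrector N m a h = 0.
  apply: (roots_geq_poly_eq0 rts) => //.
  rewrite st /corrector dH scale0r sub0r size_polyN (leq_trans (size_poly _ _))
    //.
have := alt 0%N; rewrite c0 !horner0 mulr0 ltxx =>
  /(_ (leq_ltn_trans (leq0n _) mr)).
by [].
Qed.

(** A form of rank at most m has an apolar polynomial of degree at most m,
    whose coefficients are in the kernel of the Hankel matrix. *)
Lemma rank_gt_hankel (R : realFieldType) m (a : nat -> R) xs :
  \det (hankel m a) != 0 ->
  (forall k, (k <= 2 * m + 1)%N -> a k = power_sum xs (2 * m + 1) k) ->
  (m < size xs)%N.
Proof.
move=> dH axs; rewrite ltnNge; apply/negP => sx.
have sd : (size xs <= 2 * m + 1)%N by rewrite (leq_trans sx) //; lia.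
have [g [g0 sg _ ag]] := power_sum_annihilator sd.
case/eqP: g0; apply: (@hankel_kernel _ (2 * m + 1).+1 m a) => //; first by lia.
  exact: leq_trans sg _.
move=> i im; rewrite -[RHS](ag 'X^i); last first.
  by rewrite size_polyXn (leq_trans (leq_add (im : (i < m.+1)%N) sx)) //; lia.
by apply: eq_pairing => k; exact: axs.
Qed.

(** When the Hankel matrix is invertible, the corrector of a monic h of degree
    m + 1 is, up to a scalar, the only apolar polynomial of degree m + 1. A
    form of rank m + 1 would make it a product of real linear factors. *)
Lemma rank_gt_laguerre0 (R : realFieldType) m (a : nat -> R) (h : {poly R}) xs :
  \det (hankel m a) != 0 -> h \is monic -> size h = m.+2 ->
  laguerre0 (corrector (2 * m + 1).+1 m a h) < 0 ->
  (forall k, (k <= 2 * m + 1)%N -> a k = power_sum xs (2 * m + 1) k) ->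
  (m.+1 < size xs)%N.
Proof.
move=> dH mh sh; set G := corrector _ _ _ _ => lG axs; rewrite ltnNge;
  apply/negP => sx.
have sd : (size xs <= 2 * m + 1)%N by rewrite (leq_trans sx) //; lia.
have [g [g0 sg lg ag]] := power_sum_annihilator sd.
have Gm : G`_m.+1 = \det (hankel m a).
  rewrite coefB coefZ [X in _ - X]nth_default ?size_poly // subr0.
  by move/monicP: mh; rewrite lead_coefE sh => ->; rewrite mulr1.
have e : \det (hankel m a) *: g - g`_m.+1 *: G = 0.
  apply: (@hankel_kernel _ (2 * m + 1).+1 m a) => //; first by lia.
    apply/leq_sizeP => j; rewrite leq_eqVlt coefB !coefZ => /predU1P[<-|mj].
      by rewrite Gm mulrC subrr.
    rewrite [g`_j]nth_default; last exact: leq_trans sg (leq_ltn_trans sx mj).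
    rewrite [G`_j]nth_default ?mulr0 ?subrr //.
    by rewrite (leq_trans _ mj) // size_corrector // sh.
  move=> i im; rewrite mulrBl -!scalerAl pairingB !pairingZ.
  have -> : pairing (2 * m + 1).+1 a (G * 'X^i) = 0.
    by apply: corrector_annihilates; rewrite ?size_polyXn ?sh; lia.
  rewrite mulr0 subr0 -[RHS](mulr0 (\det (hankel m a))); congr (_ * _).
  rewrite -[RHS](ag 'X^i); last first.
    by rewrite size_polyXn (leq_trans (leq_add (im : (i < m.+1)%N) sx)) //; lia.
  by apply: eq_pairing => k; exact: axs.
have eg : \det (hankel m a) *: g = g`_m.+1 *: G by apply/eqP;
  rewrite -subr_eq0 e.
have := congr1 (@laguerre0 _) eg; rewrite !laguerre0Z => le.
have gm : g`_m.+1 = 0.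
  apply/eqP; rewrite -sqrf_eq0; apply/negPn/negP => gm.
  have gm0 : 0 < g`_m.+1 ^+ 2 by rewrite lt0r gm sqr_ge0.
  have : 0 <= g`_m.+1 ^+ 2 * laguerre0 G by rewrite -le mulr_ge0 ?sqr_ge0.
  by rewrite pmulr_rge0 // leNgt lG.
by move/eqP: eg; rewrite gm scale0r scaler_eq0 (negPf dH) (negPf g0).
Qed.

(** * Moments with prescribed apolar polynomials *)

Lemma pairing_root_powers (R : idomainType) N (c : R -> R) ts (q : {poly R}) :
  (size ts + size q <= N)%N ->
  pairing N (fun k => \sum_(t <- ts) c t * t ^+ k)
    (\prod_(t <- ts) ('X - t%:P) * q) = 0.
Proof.
move=> sN; rewrite (@pairing_powers _ _ _ _ c id); last first.
  by apply: (@size_polyM_le _ _ _ (size ts).+1 (size q));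
    rewrite ?size_prod_XsubC.
rewrite big_seq big1 // => t tts; rewrite hornerM.
have /rootP -> : root (\prod_(t <- ts) ('X - t%:P)) t by rewrite
  root_prod_XsubC.
by rewrite mul0r mulr0.
Qed.

(** The Hankel matrix is the Gram matrix of p |-> (p.[t])_t. *)
Lemma hankel_positive (R : realFieldType) m (ts : seq R) :
  uniq ts -> (m < size ts)%N ->
  \det (hankel m (fun k => \sum_(t <- ts) 1 * t ^+ k)) != 0.
Proof.
move=> uts st; apply: (@hankel_nondegenerate _ (2 * m + 1) m) => [|p sp ap].
  by rewrite addn1.
apply: (roots_geq_poly_eq0 (rs := ts)); [|by []|exact: leq_trans st].
suff : \sum_(t <- ts) p.[t] ^+ 2 == 0.
  rewrite psumr_eq0 => [|t _]; last exact: sqr_ge0.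
  by move/allP => z; apply/allP => t /z; rewrite sqrf_eq0.
have <- : pairing (2 * m + 1) (fun k =>
  \sum_(t <- ts) 1 * t ^+ k) (p * p) = \sum_(t <- ts) p.[t] ^+ 2.
  rewrite (@pairing_powers _ _ _ _ (fun=> 1) id); last first.
    by apply: (size_polyM_le sp sp); lia.
  by apply: eq_bigr => t _; rewrite mul1r hornerM.
rewrite {2}(poly_sum_widen sp) mulr_sumr linear_sum big1 // => i _.
by rewrite -scalerAr linearZ /= ap ?mulr0 // -ltnS.
Qed.

(** The Lagrange weights 1 / \prod_(s != t) (t - s), obtained from the
    sequence of moments 0, ..., 0, 1: since there are as many nodes as
    moments, every sequence of moments is a combination of powers of the
    nodes. *)
Lemma divided_difference (R : fieldType) (ts : seq R) :
  uniq ts -> (0 < size ts)%N -> exists w : R -> R,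
    (forall t, t \in ts -> w t != 0) /\
    forall h : {poly R}, (size h <= size ts)%N ->
      \sum_(t <- ts) w t * h.[t] = h`_(size ts).-1.
Proof.
move=> uts s0; pose n := size ts.
have [q|w wE] := @power_sum_of_split_annihilator _ n (fun k =>
  (k == n.-1)%:R : R) ts uts (leqnn _).
  by rewrite /n -[X in (_ <= X)%N]add0n leq_add2r leqn0 size_poly_eq0 =>
    /eqP ->; rewrite mulr0 linear0.
have wh (h : {poly R}) : (size h <= size ts)%N ->
  \sum_(t <- ts) w t * h.[t] = h`_(size ts).-1.
  move=> sh; rewrite -(@pairing_powers _ n _ ts w id) //.
  rewrite -(eq_pairing (a := fun k => (k == n.-1)%:R)) //.
  have ln : (n.-1 < n)%N by rewrite prednK.
  rewrite /pairing (bigD1 (Ordinal ln)) //= eqxx mulr1 big1 ?addr0 // => i.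
  by rewrite -val_eqE /= => /negPf ->; rewrite mulr0.
exists w; split=> // t tts.
pose h := \prod_(s <- rem t ts) ('X - s%:P).
have sh : size h = n by rewrite size_prod_XsubC size_rem // prednK.
have := wh h; rewrite sh leqnn => /(_ isT).
rewrite (big_rem t) //= big_seq big1 => [|s srem]; last first.
  have /rootP -> : root h s by rewrite root_prod_XsubC.
  by rewrite mulr0.
move=> e; apply: contra_neq (oner_neq0 R) => wt0.
have /monicP : h \is monic by exact: monic_prod_XsubC.
by rewrite lead_coefE sh -e wt0 mul0r addr0.
Qed.

(** The weights w t / g.[t] make g apolar to the form. If p of degree at most
    m were apolar too, then for each node s the combination g.[s] p - p.[s] g,
    which vanishes at s, would vanish at every other node t: test it against
    the product of the remaining m factors. Having m + 2 roots it is 0, and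
    its coefficient of degree m + 1 gives p.[s] = 0. *)
Lemma hankel_weighted (R : fieldType) m (ts : seq R) (w : R -> R)
    (g : {poly R}) :
  uniq ts -> size ts = m.+2 ->
  (forall t, t \in ts -> w t != 0) ->
  (forall h : {poly R}, (size h <= m.+2)%N ->
    \sum_(t <- ts) w t * h.[t] = h`_m.+1) ->
  g \is monic -> size g = m.+2 -> (forall t, t \in ts -> g.[t] != 0) ->
  \det (hankel m (fun k => \sum_(t <- ts) w t / g.[t] * t ^+ k)) != 0.
Proof.
move=> uts st w0 wh mg sg g0.
apply: (@hankel_nondegenerate _ (2 * m + 1) m) => [|p sp ap];
  first by rewrite addn1.
have ph (h : {poly R}) : (size h <= m.+1)%N ->
  \sum_(t <- ts) w t / g.[t] * (p * h).[t] = 0.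
  move=> sh; rewrite -(@pairing_powers _ (2 * m + 1) _ _ (fun t =>
    w t / g.[t]) id); last first.
    by apply: (size_polyM_le sp sh); lia.
  rewrite (poly_sum_widen sh) mulr_sumr linear_sum big1 // => i _.
  by rewrite -scalerAr linearZ /= ap ?mulr0 // -ltnS.
have gh (h : {poly R}) : (size h <= m.+1)%N ->
  \sum_(t <- ts) w t / g.[t] * (g * h).[t] = 0.
  move=> sh; rewrite -[RHS](_ : h`_m.+1 = 0); last by rewrite nth_default.
  rewrite -wh ?(leqW sh) // big_seq [in RHS]big_seq; apply: eq_bigr => t tts.
  by rewrite hornerM; field; exact: g0.
have gm : g`_m.+1 = 1 by move/monicP: mg; rewrite lead_coefE sg.
apply: (roots_geq_poly_eq0 (rs := ts)); last 2 first.
- by [].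
- by rewrite st (leq_trans sp).
apply/allP => s sts; rewrite rootE.
pose q := g.[s] *: p - p.[s] *: g.
have sq : (size q <= m.+2)%N.
  rewrite (leq_trans (size_polyD _ _)) // geq_max size_polyN.
  rewrite (leq_trans (size_scale_leq _ _)) ?(leq_trans sp) //.
  by rewrite (leq_trans (size_scale_leq _ _)) // sg.
have rq : all (root q) ts.
  apply/allP => t tts; have [->|ts0] := eqVneq t s.
    by rewrite rootE !hornerE mulrC subrr.
  pose h := \prod_(r <- rem t (rem s ts)) ('X - r%:P).
  have trem : t \in rem s ts by rewrite mem_rem_uniq // inE ts0.
  have sh : size h = m.+1 by rewrite size_prod_XsubC !size_rem ?st.
  have : \sum_(r <- ts) w r / g.[r] * (q * h).[r] = 0.
    rewrite (eq_bigr (fun r => g.[s] * (w r / g.[r] * (p * h).[r])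
                               - p.[s] * (w r / g.[r] * (g * h).[r])));
                                 last first.
      by move=> r _; rewrite !hornerM hornerD hornerN !hornerZ; ring.
    by rewrite sumrB -!mulr_sumr ph ?sh // gh ?sh // !mulr0 subrr.
  rewrite (big_rem s) //= (big_rem t) //= big_seq big1 => [|r rr]; last first.
    have /rootP hr : root h r by rewrite root_prod_XsubC.
    by rewrite hornerM hr !mulr0.
  rewrite [X in X + _](_ : _ = 0);
    last by rewrite hornerM /q hornerD hornerN !hornerZ; ring.
  rewrite add0r addr0 hornerM => /eqP; rewrite !mulf_eq0 invr_eq0.
  rewrite (negPf (w0 _ tts)) (negPf (g0 _ tts)) /= => /orP[//|].
  rewrite -rootE root_prod_XsubC mem_rem_uniq ?rem_uniq // inE eqxx.
  by [].
have q0 : q = 0.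
  by apply: (roots_geq_poly_eq0 rq); rewrite ?st.
have := coef0 R m.+1;
  rewrite -q0 coefB !coefZ gm nth_default // mulr0 sub0r mulr1.
by move=> e; rewrite -oppr_eq0 e.
Qed.

(** * Binary forms and their moments *)

Lemma dhomog_linear_form (R : realType) (u v : R) :
  u *: mpolyX R (mnm1 ord0) + v *: mpolyX R (mnm1 (lift ord0 ord0))
    \is @ishomog1 2 R 1 mdeg.
Proof. by apply: rpredD; apply: rpredZ; rewrite dhomogX /= mdeg1. Qed.

Lemma mcoeff_linear_power (R : realType) (u v : R) d k : (k <= d)%N ->
  mcoeff (Multinom [tuple (d - k)%N; k])
    ((u *: mpolyX R (mnm1 ord0) + v *: mpolyX R (mnm1 (lift ord0 ord0)) :
      mpoly 2 R) ^+ d)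
  = 'C(d, k)%:R * (u ^+ (d - k) * v ^+ k).
Proof.
move=> kd; rewrite exprDn raddf_sum /=.
have monE i : mpolyX R (mnm1 ord0) ^+ (d - i) * mpolyX R (mnm1 (lift ord0 ord0))
  ^+ i
    = mpolyX R (Multinom [tuple (d - i)%N; i]) :> mpoly 2 R.
  rewrite !mpolyXn -mpolyXD; congr mpolyX; apply/mnmP => j.
  rewrite mnmDE !mulmnE !mnm1E.
  by case: (unliftP ord0 j) => [l|] ->;
    rewrite ?ord1 //= ?muln0 ?muln1 ?mul0n ?mul1n ?addn0.
rewrite (bigD1 (Ordinal (kd : (k < d.+1)%N))) //= big1 => [|i ik];
  rewrite raddfMn /= !exprZn -scalerAl -scalerAr !mcoeffZ monE mcoeffX.
  by rewrite (eqxx (Multinom [tuple (d - k)%N; k])) mulr1 addr0 mulr_natl.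
rewrite [_ == _]negbTE ?mulr0 ?mul0rn //; apply: contra ik => /eqP e.
have ek : nat_of_ord i = k := congr1 (fun m : multinom 2 =>
  m (lift ord0 ord0)) e.
by rewrite -val_eqE /= ek.
Qed.

Lemma linear_form_of_dhomog (R : realType) (L : dhomog 2 R 1) :
  exists u v : R, (L : mpoly 2 R)
    = u *: mpolyX R (mnm1 ord0) + v *: mpolyX R (mnm1 (lift ord0 ord0)).
Proof.
pose u := form_coefs L 0 0; pose v := form_coefs L 0 (lift ord0 ord0).
exists u, v; rewrite -[RHS]/(val (DHomog (dhomog_linear_form u v))); congr val.
apply: (bij_inj (form_coefs_bij R 1)); apply/rowP => i; rewrite [RHS]mxE /=.
have i1 : (i <= 1)%N by rewrite -ltnS.
have := mcoeff_linear_power u v i1; rewrite expr1 => ->.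
case: (unliftP ord0 i) => [j|] ->; last by rewrite bin0 !mul1r mulr1.
by rewrite ord1 /= binn !mul1r.
Qed.

(** The coefficients of f divided by binomial coefficients, so that the
    moments of (x + t y)^d are the powers of t. *)
Definition moments (R : realType) d (f : dhomog 2 R d) (k : nat) : R :=
  form_coefs f 0 (inord k) / 'C(d, k)%:R.

Lemma form_coefsE (R : realType) d (f : dhomog 2 R d) (i : 'I_d.+1) :
  form_coefs f 0 i = 'C(d, i)%:R * moments f i.
Proof.
rewrite /moments inord_val mulrC divfK //.
by rewrite pnatr_eq0 -lt0n bin_gt0 -ltnS.
Qed.

Lemma form_of_moments (R : realType) d (a : nat -> R) :
  exists f : dhomog 2 R d, forall k, (k < d.+1)%N -> moments f k = a k.
Proof.
have [G _ GK] := form_coefs_bij R d.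
exists (G (\row_i ('C(d, i)%:R * a i))) => k kd.
rewrite /moments GK mxE inordK // mulrC mulKf //.
by rewrite pnatr_eq0 -lt0n bin_gt0.
Qed.

Lemma sum_of_powers_moments (R : realType) d (f : dhomog 2 R d) r :
  sum_of_powers f r -> exists xs, size xs = r /\
    forall k, (k < d.+1)%N -> moments f k = power_sum xs d k.
Proof.
move=> [c [L fE]].
pose uv i := projT1 (cid (linear_form_of_dhomog (L i))).
have uvE i : {v | (L i : mpoly 2 R) =
  uv i *: mpolyX R (mnm1 ord0) + v *: mpolyX R (mnm1 (lift ord0 ord0))}.
  by apply: cid; rewrite /uv; case: cid.
exists [seq (c i, (uv i, projT1 (uvE i))) | i <- index_enum 'I_r].
split=> [|k kd]; first by rewrite size_map -[index_enum _]enumT size_enum_ord.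
rewrite /power_sum big_map /moments mxE inordK // fE raddf_sum mulr_suml.
apply: eq_bigr => i _ /=; case: (uvE i) => v /= ->.
rewrite mcoeffZ mcoeff_linear_power // [c i * _]mulrCA [_ / _]mulrC mulKf //.
by rewrite pnatr_eq0 -lt0n bin_gt0.
Qed.

Lemma moments_sum_of_powers (R : realType) d (f : dhomog 2 R d) (ts : seq R)
    (c : R -> R) :
  (forall k, (k < d.+1)%N -> moments f k = \sum_(t <- ts) c t * t ^+ k) ->
  sum_of_powers f (size ts).
Proof.
move=> fE; pose t (i : 'I_(size ts)) := nth 0 ts i.
exists (fun i => c (t i)), (fun i => DHomog (dhomog_linear_form 1 (t i))).
have homS : \sum_(i < size ts) c (t i) *:
    (DHomog (dhomog_linear_form 1 (t i)) :
      mpoly 2 R) ^+ d \is @ishomog1 2 R d mdeg.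
  apply: rpred_sum => i _; apply: rpredZ.
  by have := dhomogMn d (dhomog_linear_form 1 (t i)); rewrite mul1n.
rewrite -[RHS]/(val (DHomog homS)); congr val.
apply: (bij_inj (form_coefs_bij R d)); apply/rowP => i.
rewrite form_coefsE fE // mxE /= raddf_sum /= (big_nth 0) big_mkord mulr_sumr.
apply: eq_bigr => j _; rewrite mcoeffZ mcoeff_linear_power -1?ltnS //.
by rewrite expr1n mul1r mulrCA.
Qed.

Local Open Scope classical_set_scope.

(** * Open conditions on forms *)

Lemma continuous_form_coef (R : realType) d (i : 'I_d.+1) :
  continuous (fun f : dhomog 2 R d => form_coefs f 0 i).
Proof.
move=> f; apply: (@continuous_comp _ _ _ (@form_coefs R d) (fun v : 'rV[R]_d.+1
  => v 0 i)).
  exact: initial_continuous.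
exact: coord_continuous.
Qed.

Lemma continuous_ext (R : realType) (T : topologicalType) (F G : T -> R) :
  F =1 G -> continuous G -> continuous F.
Proof. by move=> /funext ->. Qed.

Lemma continuous_mul (R : realType) (T : topologicalType) (F G : T -> R) :
  continuous F -> continuous G -> continuous (fun x => F x * G x).
Proof. by move=> cF cG x; apply: cvgM; [exact: cF|exact: cG]. Qed.

Lemma continuous_sub (R : realType) (T : topologicalType) (F G : T -> R) :
  continuous F -> continuous G -> continuous (fun x => F x - G x).
Proof. by move=> cF cG x; apply: cvgB; [exact: cF|exact: cG]. Qed.

Lemma continuous_sum (R : realType) (T : topologicalType) (I : Type) (r : seq I)
    (P : pred I) (F : I -> T -> R) :
  (forall i, continuous (F i)) ->
    continuous (fun x => \sum_(i <- r | P i) F i x).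
Proof. by move=> cF; apply: continuous_big => // x; exact: add_continuous. Qed.

Lemma continuous_prod (R : realType) (T : topologicalType) (I : Type)
    (r : seq I)
    (P : pred I) (F : I -> T -> R) :
  (forall i, continuous (F i)) ->
    continuous (fun x => \prod_(i <- r | P i) F i x).
Proof. by move=> cF; apply: continuous_big => // x; exact: mul_continuous. Qed.

Lemma continuous_det (R : realType) (T : topologicalType) n (A : T -> 'M[R]_n) :
  (forall i j, continuous (fun x => A x i j)) ->
    continuous (fun x => \det (A x)).
Proof.
move=> cA; apply: continuous_sum => s; apply: continuous_mul;
  first exact: cst_continuous.
by apply: continuous_prod => i; exact: cA.
Qed.

Lemma continuous_adj (R : realType) (T : topologicalType) n (A : T -> 'M[R]_n) :
  (forall i j, continuous (fun x => A x i j)) ->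
  forall i j, continuous (fun x => (\adj (A x)) i j).
Proof.
move=> cA i j; apply: continuous_ext (fun x => mxE _ _ _ _) _.
apply: continuous_mul; first exact: cst_continuous.
apply: continuous_det => k l.
apply: continuous_ext (cA (lift j k) (lift i l)) => x; by rewrite !mxE.
Qed.

Lemma continuous_moment (R : realType) d k :
  continuous (fun f : dhomog 2 R d => moments f k).
Proof.
apply: continuous_mul; first exact: continuous_form_coef.
exact: cst_continuous.
Qed.

Lemma continuous_pairing (R : realType) d N p : continuous
    (fun f : dhomog 2 R d => pairing N (moments f) p).
Proof.
apply: continuous_sum => k; apply: continuous_mul; first exact: cst_continuous.
exact: continuous_moment.
Qed.

Lemma continuous_corrector_coef (R : realType) d N m h k :
  continuous (fun f : dhomog 2 R d => (corrector N m (moments f) h)`_k).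
Proof.
have cH i j : continuous (fun f : dhomog 2 R d => (hankel m (moments f)) i j).
  by apply: continuous_ext (@continuous_moment _ _ (i + j)) => f; rewrite mxE.
apply: (@continuous_ext _ _ _ (fun f => \det (hankel m (moments f)) * h`_k -
    (rVpoly (corrector_row N m (moments f) h *m \adj (hankel m (moments
      f))))`_k)).
  by move=> f; rewrite coefB coefZ.
apply: continuous_sub; first apply: continuous_mul.
- exact: continuous_det.
- exact: cst_continuous.
apply: continuous_ext (fun f => coef_rVpoly _ _) _.
case: insubP => [i _ _|_]; last exact: cst_continuous.
apply: continuous_ext (fun f => mxE _ _ _ _) _.
apply: continuous_sum => j; apply: continuous_mul; last exact: continuous_adj.
apply: continuous_ext (fun f => mxE _ _ _ _) _.
by case: (_ + _ <= _)%N; [exact: continuous_pairing|exact: cst_continuous].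
Qed.

Lemma continuous_horner (R : realType) d n (P : dhomog 2 R d -> {poly R}) x :
  (forall f, (size (P f) <= n)%N) ->
    (forall k, continuous (fun f => (P f)`_k)) ->
  continuous (fun f => (P f).[x]).
Proof.
move=> sP cP; apply: continuous_ext (fun f => horner_coef_wide x (sP f)) _.
apply: continuous_sum => k; apply: continuous_mul; first exact: cP.
exact: cst_continuous.
Qed.

Lemma open_neg (R : realType) d (F : dhomog 2 R d -> R) : continuous F -> open
    [set f | F f < 0].
Proof.
move=> cF; apply: (@open_comp _ _ F [set x | x < 0]) => [f _|]; first exact: cF.
exact: open_lt.
Qed.

Lemma open_alternates (R : realType) d n (P : dhomog 2 R d -> {poly R}) r :
  (forall f, (size (P f) <= n)%N) ->
    (forall k, continuous (fun f => (P f)`_k)) ->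
  open [set f | alternates (P f) r].
Proof.
move=> sP cP; elim: r => [|r IH].
  rewrite (_ : mkset _ = setT); first exact: openT.
  by apply/seteqP; split.
rewrite (_ : mkset _ = [set f | alternates (P f) r] `&`
    [set f | (P f).[(2 * r)%:R] * (P f).[(2 * r.+1)%:R] < 0]); last first.
  apply/seteqP; split=> f /=.
    by move=> alt; split=> [j jr|]; apply: alt => //; exact: ltnW.
  by case=> alt altr j; rewrite ltnS leq_eqVlt => /predU1P[->//|]; exact: alt.
apply: openI => //; apply: open_neg; apply: continuous_mul;
  exact: continuous_horner sP cP.
Qed.

(** * Typical ranks *)

(** Both small ranks have this upper bound: the corrector is apolar to f, and
    alternation gives it as many distinct real roots as its degree. *)
Lemma sum_of_powers_of_corrector (R : realType) m d (f : dhomog 2 R d)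
    (h : {poly R}) r :
  d = (2 * m + 1)%N -> (m < r)%N -> (r <= m + 2)%N -> (r <= d)%N ->
    size h = r.+1 ->
  alternates (corrector d.+1 m (moments f) h) r -> sum_of_powers f r.
Proof.
move=> dE mr rm rd sh alt.
have K0 : corrector d.+1 m (moments f) h != 0.
  have := alternates_neq0 alt (leq_ltn_trans (leq0n _) mr).
  by apply: contra_neq => ->; rewrite horner0.
have [||q sq|ts [c [sts fE]]] := @power_sum_of_alternating _ d.+1 (moments f) _
  _ K0 alt.
- by rewrite size_corrector ?sh // ltnW.
- exact: leqW.
- apply: corrector_annihilates; first by lia.
    by move: sq; move: (size q) => s; lia.
  by rewrite sh; move: sq; move: (size q) => s; lia.
by rewrite -sts; exact: moments_sum_of_powers fE.
Qed.

(** The open set asks the apolar polynomial of degree m + 1 to have m + 1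
    distinct real roots separated by fixed points; it contains the sum of the
    (x + t y)^d over the odd nodes t. *)
Lemma typical_rank_generic (R : realType) m d : d = (2 * m + 1)%N -> (0 < m)%N
    ->
  typical_rank R d (m + 1).
Proof.
move=> dE m0; split; first by rewrite addn1.
pose h : {poly R} := \prod_(t <- odd_nodes R (m + 1)) ('X - t%:P).
have sh : size h = (m + 1).+1 by rewrite size_prod_XsubC size_odd_nodes.
pose G (f : dhomog 2 R d) := corrector d.+1 m (moments f) h.
have mN : (2 * m < d.+1)%N by lia.
have sG f : (size (G f) <= m.+2)%N by rewrite size_corrector ?sh ?addn1.
exists [set f | alternates (G f) (m + 1)]; split.
- pose a k := \sum_(t <- odd_nodes R (m + 1)) (1 : R) * t ^+ k.
  have [f fa] := form_of_moments d a.
  exists f => /=; rewrite /G (eq_corrector _ mN fa) corrector_fixed =>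
    [|i im _].
    apply: alternates_odd_nodes; apply: hankel_positive;
      first exact: odd_nodes_uniq.
    by rewrite size_odd_nodes addn1.
  apply: (@pairing_root_powers _ _ (fun=> 1));
    rewrite size_odd_nodes size_polyXn.
  by lia.
- by apply: open_alternates sG _ => k; exact: continuous_corrector_coef.
move=> f /= alt; split.
  by apply: sum_of_powers_of_corrector dE _ _ _ sh alt; lia.
move=> s /sum_of_powers_moments[xs [<- fE]].
rewrite addn1; apply: (@rank_gt_hankel _ m (moments f)).
  by apply: det_hankel_of_corrector alt; rewrite addn1.
by move=> k kd; rewrite -dE; apply: fE; rewrite dE ltnS.
Qed.

(** Here the apolar polynomial of degree m + 1 must have a root that is not
    real, while some apolar polynomial of degree m + 2 has only simple real
    roots. At the base point these two polynomials are g = 'X^(m+1) + 'X^2 + 1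
    and h = \prod ('X - t): dividing the Lagrange weights of the roots of h by
    the values of g makes both apolar. *)
Lemma typical_rank_generic_succ (R : realType) m d : d = (2 * m + 1)%N ->
    (1 < m)%N ->
  typical_rank R d (m + 2).
Proof.
move=> dE m1; split; first by rewrite addn2.
pose ts := odd_nodes R (m + 2).
pose h : {poly R} := \prod_(t <- ts) ('X - t%:P).
have sh : size h = (m + 2).+1 by rewrite size_prod_XsubC size_odd_nodes.
pose g2 : {poly R} := 'X^2 + 1; pose g1 : {poly R} := 'X^(m.+1).
have sg2 : (size g2 < size g1)%N.
  by rewrite size_polyXn /g2 -[1]/(1%:P) size_XnaddC // ltnS.
pose g := g1 + g2.
have sg : size g = m.+2 by rewrite size_polyDl // size_polyXn.
have mg : g \is monic by rewrite monicE lead_coefDl // lead_coefXn.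
have gpos t : t \in ts -> g.[t] != 0.
  move=> /mapP[i _ ->]; rewrite gt_eqF // /g /g1 /g2 !hornerD !hornerXn hornerC.
  by rewrite ltr_wpDl ?exprn_ge0 // ltr_wpDl ?exprn_ge0.
have lg : laguerre0 g < 0.
  rewrite /laguerre0 /g /g1 /g2 !coefD !coefXn !coef1.
  by case: (m) m1 => [|[|k]] //= _; lra.
pose K (f : dhomog 2 R d) := corrector d.+1 m (moments f) h.
pose G (f : dhomog 2 R d) := corrector d.+1 m (moments f) g.
have mN : (2 * m < d.+1)%N by lia.
have sK f : (size (K f) <= m.+3)%N by rewrite size_corrector ?sh ?addn2 // ltnS
  leqW.
exists ([set f | alternates (K f) (m + 2)] `&` [set f | laguerre0 (G f) < 0]);
  split.
- have uts : uniq ts by exact: odd_nodes_uniq.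
  have st : size ts = m.+2 by rewrite size_odd_nodes addn2.
  have [|w [w0 wh]] := divided_difference uts; first by rewrite st.
  rewrite st /= in wh.
  pose a k := \sum_(t <- ts) w t / g.[t] * t ^+ k.
  have dH : \det (hankel m a) != 0.
    exact: hankel_weighted.
  have [f fa] := form_of_moments d a.
  exists f; split=> /=;
    rewrite /K /G (eq_corrector _ mN fa) corrector_fixed => [|i im si].
  + exact: alternates_odd_nodes.
  + apply: (@pairing_root_powers _ _ (fun t => w t / g.[t])).
    by rewrite size_odd_nodes size_polyXn; move: si; rewrite sh; lia.
  + by rewrite laguerre0Z pmulr_rlt0 // exprn_even_gt0.
  + rewrite (@pairing_powers _ _ _ _ (fun t => w t / g.[t]) id); last first.
      by apply: (@size_polyM_le _ _ _ m.+2 i.+1); rewrite ?sg ?size_polyXn //;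
        lia.
    rewrite -[RHS](_ : ('X^i : {poly R})`_m.+1 = 0); last first.
      by rewrite coefXn gtn_eqF.
    rewrite -(wh 'X^i); last by rewrite size_polyXn ltnS leqW.
    rewrite big_seq [RHS]big_seq; apply: eq_bigr => t tts.
    by rewrite hornerM; field; exact: gpos.
- apply: openI; first by apply: open_alternates sK _ => k;
  exact: continuous_corrector_coef.
  apply: open_neg; apply: continuous_sub.
    by apply: continuous_mul; exact: continuous_corrector_coef.
  apply: continuous_ext (fun f => esym (mulr_natl _ _)) _.
  apply: continuous_mul; first exact: cst_continuous.
  by apply: continuous_mul; exact: continuous_corrector_coef.
move=> f [/= alt lG]; split.
  by apply: sum_of_powers_of_corrector dE _ _ _ sh alt; lia.
move=> s /sum_of_powers_moments[xs [<- fE]].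
rewrite addn2; apply: (@rank_gt_laguerre0 _ m (moments f) g) => //.
- by apply: det_hankel_of_corrector alt; rewrite addn2 ltnW.
- by rewrite -dE.
by move=> k kd; rewrite -dE; apply: fE; rewrite dE ltnS.
Qed.

Definition dehomogenize (R : realType) d (f : dhomog 2 R d) : {poly R} :=
  \poly_(k < d.+1) ('C(d, k)%:R * moments f k).

Lemma horner_dehomogenize (R : realType) d (f : dhomog 2 R d) xs t :
  (forall k, (k < d.+1)%N -> moments f k = power_sum xs d k) ->
  (dehomogenize f).[t] = linear_powers xs d 1 t.
Proof.
move=> fE; rewrite horner_poly /linear_powers.
under [RHS]eq_bigr do rewrite mulr1 exprDn mulr_sumr.
rewrite exchange_big /=; apply: eq_bigr => k _.
rewrite fE // mulr_sumr mulr_suml; apply: eq_bigr => w _.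
by rewrite -mulr_natl exprMn; ring.
Qed.

(** The open set consists of forms with d distinct real roots. A sum of fewer
    than d powers cannot have that many. *)
Lemma typical_rank_odd_degree (R : realType) d : odd d -> typical_rank R d d.
Proof.
move=> od; have d0 : (0 < d)%N by case: d od.
split=> //; pose G (f : dhomog 2 R d) := dehomogenize f.
have sG f : (size (G f) <= d.+1)%N by exact: size_poly.
have cG k : continuous (fun f => (G f)`_k).
  apply: continuous_ext (fun f => coef_poly _ _ _) _.
  case: (k < d.+1)%N; last exact: cst_continuous.
  apply: continuous_mul; first exact: cst_continuous.
  exact: continuous_moment.
(* the second condition says that the coefficient of y^d is not 0; the one of
   x^d is not 0 because 0 is among the points where the sign is tested *)
exists ([set f | alternates (G f) d] `&` [set f | - ((G f)`_d * (G f)`_d) < 0]);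
  split.
- pose h : {poly R} := \prod_(t <- odd_nodes R d) ('X - t%:P).
  have sh : size h = d.+1 by rewrite size_prod_XsubC size_odd_nodes.
  have [f fa] := form_of_moments d (fun k => h`_k / 'C(d, k)%:R).
  have Gh : G f = h.
    apply/polyP => k; rewrite coef_poly; case: ltnP => kd.
      by rewrite fa // mulrC divfK // pnatr_eq0 -lt0n bin_gt0.
    by rewrite nth_default // sh.
  exists f; split=> /=; rewrite Gh.
    by have := @alternates_odd_nodes R d 1 (oner_neq0 R); rewrite scale1r.
  have /monicP : h \is monic by exact: monic_prod_XsubC.
  by rewrite lead_coefE sh /= => ->; rewrite mulr1 oppr_lt0.
- apply: openI; first exact: open_alternates sG cG.
  apply: open_neg; apply: continuous_ext (fun f => esym (mulN1r _)) _.
  by apply: continuous_mul; [exact: cst_continuous|exact: continuous_mul].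
move=> f [/= alt lead]; have G0 := alternates_neq0 alt d0; split.
  have [||ts [c [sts fE]]] := @power_sum_of_odd_degree R d (moments f) od.
  - by apply: contraNneq G0; rewrite horner_coef0 coef_poly /= => ->;
    rewrite mulr0.
  - apply: contraTneq lead; rewrite coef_poly ltnSn => ->.
    by rewrite !mulr0 oppr0 ltxx.
  by rewrite -[X in sum_of_powers _ X]sts; exact: moments_sum_of_powers fE.
move=> s /sum_of_powers_moments[xs [<- fE]].
rewrite leqNgt; apply/negP => sxs; case/eqP: G0.
have [ts [uts sts rts]] := alternates_roots alt.
rewrite (horner_dehomogenize _ fE).
apply: (@linear_powers_few_zeros _ xs d [seq (1, t) | t <- ts]).
- exact: ltnW.
- by rewrite size_map sts.
- rewrite pairwise_map; move: uts; rewrite uniq_pairwise;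
  apply: sub_pairwise => x y /= xy.
  by rewrite /wedge /= mul1r mulr1 subr_eq0 eq_sym.
- by rewrite all_map; apply/allP => t _ /=; rewrite xpair_eqE oner_eq0.
- rewrite all_map; apply: sub_all rts => t /=.
  by rewrite -(horner_dehomogenize _ fE).
Qed.

Theorem theorem2 (R : realType) (d m : nat)
    (hd : d = (2 * m + 1)%N) (hd5 : (5 <= d)%N) :
  [/\ typical_rank R d (m + 1)%N, typical_rank R d (m + 2)%N
    & typical_rank R d (2 * m + 1)%N].
Proof.
have m1 : (1 < m)%N by lia.
split; first by apply: typical_rank_generic => //; exact: ltnW.
  exact: typical_rank_generic_succ.
by rewrite -hd; apply: typical_rank_odd_degree; rewrite hd; lia.
Qed.
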